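(* Let $n\geq 1$ be an integer and let $d\in\{0,1,\ldots,n-1\}$. Then $$\sum_{k=0}^{n-1}q^{-k(k+3)/2}{2k\brack k+d}_q(-q^{k+1}; q)_{n-k-1}\equiv\begin{cases}(-1)^{\frac{n+d-2}{2}}q^{\frac{5-(n-d+1)^2}{4}}(1-q^{n-d}), &\text{if } n-d \text{ is even}\\ (-1)^{\frac{n+d-1}{2}}q^{\frac{5-(n-d)^2}{4}}, &\text{if } n-d \text{ is odd}\end{cases}\pmod{\Phi_n(q)},$$ $$\sum_{k=0}^{n-1}q^{-k(k+3)/2}{2k\brack k+d}_q(-q^{k}; q)_{n-k-1}\equiv\begin{cases}(-1)^{\frac{n+d-2}{2}}q^{\frac{9-(n-d+1)^2}{4}}\dfrac{1-q^{n-d}}{1+q}, &\text{if } n-d \text{ is even}\\ (-1)^{\frac{n+d-1}{2}}q^{\frac{5-(n-d)^2}{4}}, &\text{if } n-d \text{ is odd}\end{cases}\pmod{\Phi_n(q)}.$$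
   Context: $(z;q)_n=(1-z)(1-zq)\cdots(1-zq^{n-1})$ for $n\ge 0$ (with $(z;q)_0=1$). ${n\brack k}_q$ is the $q$-binomial coefficient, equal to $\frac{(q;q)_n}{(q;q)_k(q;q)_{n-k}}$ if $0\le k\le n$ and $0$ otherwise; it is a polynomial in $q$ with integer coefficients. $\Phi_n(q)$ is the $n$th cyclotomic polynomial. Congruences are between Laurent polynomials, i.e. in the ring $\mathbb{Z}[q,q^{-1}]$; when $n-d$ is even, $(1-q^{n-d})/(1+q)$ is a polynomial in $q$. *)

(* Defs.v *)
From HB Require Import structures.
From mathcomp Require Import all_boot all_order all_algebra all_field.

Set Implicit Arguments.
Unset Strict Implicit.
Unset Printing Implicit Defensive.

Import GRing.Theory.
Local Open Scope ring_scope.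

(* (z; q)_n *)
Definition qpoch (R : comUnitRingType) (z q : R) (n : nat) : R :=
  \prod_(i < n) (1 - z * q ^+ i).

(* The quotient formula is meaningful only when no q ^+ i with 0 < i <= n
   equals 1; it is used below at the indeterminate. *)
Definition qbinom (F : fieldType) (q : F) (n k : nat) : F :=
  if (k <= n)%N then qpoch q q n / (qpoch q q k * qpoch q q (n - k)) else 0.

(* Z[q, q^-1] is represented as a subring of Z(q) = Frac(Z[q]), so that the
   quotients in the q-binomials and in (1 - q^m) / (1 + q) are true quotients
   and q has integer powers. *)
Definition Zq : fieldType := {fraction {poly int}}.

Definition qvar : Zq := tofrac ('X : {poly int}).

Definition is_laurent (f : Zq) : Prop :=
  exists (p : {poly int}) (m : nat), f = tofrac p / qvar ^+ m.

(* Congruence in the ring Z[q, q^-1]: both sides are required to be Laurent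
   polynomials, and so is the cofactor. *)
Definition laurent_eqmod (P f g : Zq) : Prop :=
  [/\ is_laurent f, is_laurent g &
      exists2 h : Zq, is_laurent h & f - g = P * h].

Definition Phi (n : nat) : Zq := tofrac ('Phi_n : {poly int}).

(* Main.v *)
Require Import Defs.
From HB Require Import structures.
From mathcomp Require Import all_boot all_order all_algebra all_field.
From mathcomp Require Import ring zify.
Set Implicit Arguments.
Unset Strict Implicit.
Unset Printing Implicit Defensive.
Import GRing.Theory.
Local Open Scope ring_scope.

(* Since Phi_n is the minimal polynomial of a primitive n-th root of unity z,
   it suffices to compare values at q = z.  Up to a factor 2, let A_d and B_d
   be the values of the sums over k < n of
     q^(-k(k+3)/2) [2k, k+d] (-q^(k+1); q)_(n-k-1)   and
     q^(-k(k+1)/2) [2k, k+d] (-q^(k+1); q)_(n-k-1).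
   The first sum of the theorem is A_d, and (1 + z^(n-1)) times the second is
   A_d + B_d.  Telescoping in k, with [2n, n+d] = 0 at z for 0 < d < n, gives
   for 0 < d < n
     B_(d-1) = - z^d B_(d+1)   and   A_d = z (B_(d-1) + B_d + B_(d+1)),
   with a correction from the boundary for A_0.  Starting from B_n = 0 and
   the one-term sum B_(n-1), this determines all B_d and then all A_d.  As
   1 + z^(n-1) vanishes for n = 2, that case is computed directly. *)

(** * Polynomial q-binomials *)

(** Defined by the q-Pascal rule, without division, so that it still makes sense when [q] is a root
    of unity. *)
Fixpoint qbin (R : comNzRingType) (q : R) (m j : nat) : R :=
  match m, j with
  | _, 0%N => 1
  | 0%N, _.+1 => 0
  | m'.+1, j'.+1 => qbin q m' j' + q ^+ j * qbin q m' j
  end.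

Lemma qbin0 (R : comNzRingType) (q : R) m : qbin q m 0 = 1.
Proof. by case: m. Qed.

Lemma qbinS (R : comNzRingType) (q : R) m j :
  qbin q m.+1 j.+1 = qbin q m j + q ^+ j.+1 * qbin q m j.+1.
Proof. by []. Qed.

Lemma qbin_small (R : comNzRingType) (q : R) m j : (m < j)%N -> qbin q m j = 0.
Proof.
elim: m j => [|m IH] [|j] //= lt_mj.
by rewrite !IH ?mulr0 ?addr0 //; apply: ltnW.
Qed.

Lemma qbinn (R : comNzRingType) (q : R) m : qbin q m m = 1.
Proof. by elim: m => //= m ->; rewrite qbin_small // mulr0 addr0. Qed.

(* The powers of [q] are arranged so that no exponent [m - j] occurs: the
   identity then holds for all [m] and [j]. *)
Lemma qbin_succr (R : comNzRingType) (q : R) m j :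
  (q ^+ j - q ^+ m) * qbin q m j
    = q ^+ j * (1 - q ^+ j.+1) * qbin q m j.+1.
Proof.
elim: m j => [|m IH] [|j].
- by rewrite /= !expr0; ring.
- by rewrite /=; ring.
- rewrite qbin0 qbinS qbin0 expr0.
  have := IH 0%N; rewrite qbin0 expr0 => H.
  have -> : 1 * (1 - q ^+ 1) * (1 + q ^+ 1 * qbin q m 1)
    = (1 - q ^+ 1) + q * (1 * (1 - q ^+ 1) * qbin q m 1) by ring.
  by rewrite -H exprS; ring.
- rewrite !qbinS.
  have Hx := IH j; have Hy := IH j.+1.
  have -> : (q ^+ j.+1 - q ^+ m.+1) * (qbin q m j + q ^+ j.+1 * qbin q m j.+1)
    = q * ((q ^+ j - q ^+ m) * qbin q m j)
      + q ^+ j.+1 * (q ^+ j.+1 - q ^+ m.+1) * qbin q m j.+1.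
    by rewrite !exprS; ring.
  have -> : q ^+ j.+1 * (1 - q ^+ j.+2) * (qbin q m j.+1 + q ^+ j.+2 * qbin q m j.+2)
    = q ^+ j.+1 * (1 - q ^+ j.+2) * qbin q m j.+1
      + q ^+ j.+2 * (q ^+ j.+1 * (1 - q ^+ j.+2) * qbin q m j.+2) by ring.
  by rewrite Hx -Hy !exprS; ring.
Qed.

(** The second q-Pascal rule, multiplied by [q ^+ j] to avoid the exponent [m - j]. *)
Lemma qbinS_alt (R : comNzRingType) (q : R) m j :
  q ^+ j * qbin q m.+1 j.+1 = q ^+ m * qbin q m j + q ^+ j * qbin q m j.+1.
Proof.
have H := qbin_succr q m j; rewrite qbinS.
have -> : q ^+ m * qbin q m j
    = q ^+ j * qbin q m j - (q ^+ j - q ^+ m) * qbin q m j by ring.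
by rewrite H; ring.
Qed.

(** The two q-Pascal rules mirror each other: [qbinS] expands the left side, [qbinS_alt] the right
    side, and induction on [i + j] matches the terms. *)
Lemma qbin_sym (F : fieldType) (q : F) i j :
  q != 0 -> qbin q (i + j) i = qbin q (i + j) j.
Proof.
move=> q0; have [m] := ubnP (i + j)%N; elim: m i j => // m IH [|i] [|j] //.
- by rewrite add0n qbin0 qbinn.
- by rewrite addn0 qbin0 qbinn.
- rewrite ltnS => le_ijm.
  apply: (mulfI (expf_neq0 j q0)).
  rewrite addSn qbinS_alt qbinS.
  rewrite [qbin q (i + j.+1) i]IH; last lia.
  have E : (i + j.+1 = i.+1 + j)%N by lia.
  rewrite E [qbin q (i.+1 + j) i.+1]IH; last lia.
  by rewrite -E exprD !exprS; ring.
Qed.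

Lemma qpochSr (R : comUnitRingType) (x q : R) m :
  qpoch x q m.+1 = qpoch x q m * (1 - x * q ^+ m).
Proof. by rewrite /qpoch big_ord_recr. Qed.

Lemma qpochSl (R : comUnitRingType) (x q : R) m :
  qpoch x q m.+1 = (1 - x) * qpoch (x * q) q m.
Proof.
rewrite /qpoch big_ord_recl expr0 mulr1; congr (_ * _).
by apply: eq_bigr => i _; rewrite lift0 exprS mulrA.
Qed.

Lemma qbin_qpoch (F : fieldType) (q : F) m j : q != 0 -> (j <= m)%N ->
  qbin q m j * (qpoch q q j * qpoch q q (m - j)) = qpoch q q m.
Proof.
move=> q0; elim: j => [|j IH] lt_jm.
  by rewrite qbin0 subn0 {1}/qpoch big_ord0 !mul1r.
rewrite -(IH (ltnW lt_jm)).
have [p Em] : exists p, m = (j + p.+1)%N by exists (m - j).-1; lia.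
have E1 : (m - j.+1 = p)%N by lia.
have E2 : (m - j = p.+1)%N by lia.
rewrite E1 E2 2!qpochSr.
have := qbin_succr q m j.
have -> : q ^+ m = q ^+ j * q ^+ p.+1 by rewrite Em exprD.
have -> : (q ^+ j - q ^+ j * q ^+ p.+1) * qbin q m j
   = q ^+ j * ((1 - q ^+ p.+1) * qbin q m j) by ring.
rewrite -mulrA => /(mulfI (expf_neq0 j q0)) H.
have -> : qbin q m j.+1 * (qpoch q q j * (1 - q * q ^+ j) * qpoch q q p)
  = (1 - q ^+ j.+1) * qbin q m j.+1 * (qpoch q q j * qpoch q q p).
  by rewrite exprS; ring.
by rewrite -H exprS; ring.
Qed.

Lemma qpoch_qq_neq0 (F : fieldType) (q : F) m :
  (forall i, q ^+ i.+1 != 1) -> qpoch q q m != 0.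
Proof.
move=> q1; apply/prodf_neq0 => i _.
by rewrite -exprS subr_eq0 eq_sym.
Qed.

Lemma qbinomE (F : fieldType) (q : F) m j :
  q != 0 -> (forall i, q ^+ i.+1 != 1) -> qbinom q m j = qbin q m j.
Proof.
move=> q0 q1; rewrite /qbinom; case: leqP => [le_jm|/qbin_small-> //].
rewrite -(qbin_qpoch q0 le_jm) mulfK //.
by rewrite mulf_neq0 ?qpoch_qq_neq0.
Qed.

(* [a], [b], [c] stand for the [q]-binomials [2k, k+d-1], [2k, k+d],
   [2k, k+d+1] and [e] for [2k+2, k+1+d], with [K = q^k] and [D = q^d]. *)
Definition central_rel (F : fieldType) (q K D a b c e : F) :=
  [/\ (D - q * K) * a = D * (1 - K * D) * b,
      (D - K) * b = D * (1 - q * K * D) * c &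
      e = a + (q * K ^+ 2 + K * D) * b + q * K * D * c].

(** The two sides differ by the sum of the two contiguity relations. Multiplied by [q K] and the
    weight at [k + 1], the right side becomes [1 + D] times a difference in [k]. *)
Lemma central_rel_telescope1 (F : fieldType) (q K D a b c e : F) :
  central_rel q K D a b c e ->
  (1 + q * K) * (a + D * c) = (1 + D) * (e - K * (1 + q * K) * b).
Proof.
case=> ra rc ->; apply/eqP; rewrite -subr_eq0; apply/eqP.
transitivity (D * (1 - K * D) * b - (D - q * K) * a
   + (D * (1 - q * K * D) * c - (D - K) * b)); first by ring.
by rewrite ra rc; ring.
Qed.

(** Again a combination of the two contiguity relations, now with coefficients [q (1 - q K D) / D]
    and [- q^2 K (1 + D) / D]. It writes the weighted [b / K] as that of [q (a + b + c)] plus a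
    difference in [k]. *)
Lemma central_rel_telescope2 (F : fieldType) (q K D a b c e : F) :
  D != 0 -> central_rel q K D a b c e ->
  q * (1 + q * K) * b = q ^+ 2 * K * (1 + q * K) * (a + b + c)
    + (q - q ^+ 2 * (1 + D + D^-1) * K) * e
    - (q - q * (1 + D + D^-1) * K) * (q * K * (1 + q * K)) * b.
Proof.
move=> D0 [ra rc ->]; apply/eqP; rewrite -subr_eq0; apply/eqP.
transitivity (q * (1 - q * K * D) / D * (D * (1 - K * D) * b - (D - q * K) * a)
   - q ^+ 2 * K * (1 + D) / D * (D * (1 - q * K * D) * c - (D - K) * b)).
  by field.
by rewrite ra rc; ring.
Qed.

Lemma qbin_central_rel (F : fieldType) (q : F) k d : q != 0 ->
  central_rel q (q ^+ k) (q ^+ d.+1) (qbin q (2 * k) (k + d))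
    (qbin q (2 * k) (k + d.+1)) (qbin q (2 * k) (k + d.+2))
    (qbin q (2 * k.+1) (k.+1 + d.+1)).
Proof.
move=> q0; have qk0 := expf_neq0 k q0.
have E2 : q ^+ (2 * k) = q ^+ k * q ^+ k by rewrite -exprD; congr (_ ^+ _); lia.
split.
- apply: (mulfI qk0); have := qbin_succr q (2 * k) (k + d).
  rewrite -addnS E2 !exprD !exprS => H.
  transitivity (q * ((q ^+ k * q ^+ d - q ^+ k * q ^+ k) * qbin q (2 * k) (k + d))).
    by ring.
  by rewrite H; ring.
- apply: (mulfI qk0); have := qbin_succr q (2 * k) (k + d.+1).
  rewrite -addnS E2 !exprD !exprS => H.
  transitivity ((q ^+ k * (q * q ^+ d) - q ^+ k * q ^+ k) * qbin q (2 * k) (k + d.+1)).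
    by ring.
  by rewrite H; ring.
- rewrite (_ : (2 * k.+1 = (2 * k).+2)%N); last lia.
  rewrite addSn (addnS k d) 2!qbinS.
  (* The power is split so that the second q-Pascal rule applies; it produces [q ^+ (2 * k)], that
     is [K ^+ 2]. *)
  rewrite (_ : q ^+ (k + d).+2 * qbin q (2 * k).+1 (k + d).+2
    = q * (q ^+ (k + d).+1 * qbin q (2 * k).+1 (k + d).+2)); last first.
    by rewrite [q ^+ _.+2]exprS mulrA.
  rewrite qbinS_alt E2 !addnS !exprS exprD; ring.
Qed.

(* By symmetry [2k, k+1] replaces [2k, k-1], whose index would be truncated
   at [k = 0]. *)
Lemma qbin_central_rel0 (F : fieldType) (q : F) k : q != 0 ->
  central_rel q (q ^+ k) 1 (qbin q (2 * k) k.+1)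
    (qbin q (2 * k) k) (qbin q (2 * k) k.+1) (qbin q (2 * k.+1) k.+1).
Proof.
move=> q0; have qk0 := expf_neq0 k q0.
have E2 : q ^+ (2 * k) = q ^+ k * q ^+ k by rewrite -exprD; congr (_ ^+ _); lia.
have rc : (1 - q ^+ k) * qbin q (2 * k) k
     = 1 * (1 - q * q ^+ k * 1) * qbin q (2 * k) k.+1.
  apply: (mulfI qk0); have := qbin_succr q (2 * k) k.
  rewrite E2 !exprS => H.
  transitivity ((q ^+ k - q ^+ k * q ^+ k) * qbin q (2 * k) k); first by ring.
  by rewrite H; ring.
split=> //.
- by move: rc; rewrite !mul1r !mulr1.
- rewrite (_ : (2 * k.+1 = (2 * k).+2)%N); last lia.
  have -> : qbin q (2 * k).+2 k.+1
    = qbin q (2 * k).+1 k + q * (q ^+ k * qbin q (2 * k).+1 k.+1).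
    by rewrite qbinS exprS mulrA.
  rewrite qbinS_alt E2.
  case: k {rc E2} qk0 => [|k] _; first by rewrite muln0 /=; ring.
  rewrite [qbin q (2 * k.+1).+1 k.+1]qbinS.
  have -> : (2 * k.+1 = k + k.+2)%N by lia.
  by rewrite (@qbin_sym _ q k k.+2 q0); ring.
Qed.

(** * The two sums at a root of unity *)

Lemma prim_root_neq0 (F : fieldType) n (z : F) : n.-primitive_root z -> z != 0.
Proof.
move=> pz; have n0 := prim_order_gt0 pz.
apply/eqP => z0; have := prim_expr_order pz.
by rewrite z0 expr0n gtn_eqF // => /esym/eqP; rewrite oner_eq0.
Qed.

Lemma prim_expr_neq1 (F : fieldType) n (z : F) i :
  n.-primitive_root z -> (0 < i < n)%N -> z ^+ i != 1.
Proof. by move=> pz /andP[i0 lt_in]; rewrite -(prim_order_dvd pz) gtnNdvd. Qed.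

Lemma prim_half (F : fieldType) j (z : F) :
  (2 * j).-primitive_root z -> z ^+ j = -1.
Proof.
move=> pz; have j0 := prim_order_gt0 pz.
have /eqP : (z ^+ j) ^+ 2 = 1 by rewrite -exprM mulnC (prim_expr_order pz).
rewrite sqrf_eq1 => /orP[|/eqP//].
by rewrite (negPf (prim_expr_neq1 pz _)) //; lia.
Qed.

(** Evaluate the factorization of [X^n - 1] into the [X - z^i] at -1. *)
Lemma prim_prod1D (F : fieldType) n (z : F) : n.-primitive_root z ->
  \prod_(i < n) (1 + z ^+ i) = 1 - (-1) ^+ n.
Proof.
move=> pz; have := congr1 (horner^~ (-1)) (factor_Xn_sub_1 pz).
rewrite horner_prod !hornerE big_mkord => H.
transitivity ((-1) ^+ n * \prod_(i < n) ('X - (z ^+ i)%:P).[-1]).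
  rewrite -[X in _ ^+ X]card_ord -prodr_const -big_split /=.
  by apply: eq_bigr => i _; rewrite !hornerE; ring.
by rewrite H mulrBr -exprMn mulrNN mulr1 expr1n mulr1.
Qed.

(** Evaluate the same factorization at 0: the left side is the product of all [z^i] with [i < n]. *)
Lemma prim_expr_bin2 (F : fieldType) n (z : F) : n.-primitive_root z ->
  z ^+ 'C(n, 2) = (-1) ^+ n.-1.
Proof.
move=> pz; have n0 := prim_order_gt0 pz.
have := congr1 (horner^~ 0) (factor_Xn_sub_1 pz).
rewrite horner_prod !hornerE big_mkord expr0n gtn_eqF // sub0r => H.
transitivity ((-1) ^+ n * \prod_(i < n) ('X - (z ^+ i)%:P).[0]).
  rewrite -[X in _ = (-1) ^+ X * _]card_ord -prodr_const -big_split /=.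
  rewrite -bin2_sum big_mkord expr_sum; apply: eq_bigr => i _.
  by rewrite !hornerE; ring.
by rewrite H -{1}(prednK n0) exprS mulrAC mulrNN !mul1r.
Qed.

(** As [z^n = 1], [qbin_succr] reads [(z^i - 1) [n, i] = z^i (1 - z^(i+1)) [n, i+1]]. The left side
    is 0 for [i = 0] and, by induction, for larger [i]. *)
Lemma qbin_prim0 (F : fieldType) n (z : F) i : n.-primitive_root z ->
  (0 < i < n)%N -> qbin z n i = 0.
Proof.
move=> pz; have z0 := prim_root_neq0 pz.
elim: i => // i IH lt_in; have := qbin_succr z n i.
rewrite (prim_expr_order pz).
have -> : (z ^+ i - 1) * qbin z n i = 0.
  case: i IH lt_in => [|i] IH lt_in; first by rewrite expr0 subrr mul0r.
  by rewrite IH ?mulr0 //; lia.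
move/esym/eqP; rewrite !mulf_eq0 (negPf (expf_neq0 i z0)) subr_eq0 eq_sym.
by rewrite (negPf (prim_expr_neq1 pz lt_in)) => /eqP.
Qed.

(** Row [n] at [z] is 1, 0, ..., 0, 1, so the q-Pascal rule copies row [j] into the first [n]
    columns of row [n + j]. *)
Lemma qbin_prim_low (F : fieldType) n (z : F) i j : n.-primitive_root z ->
  (i < n)%N -> qbin z (n + j) i = qbin z j i.
Proof.
move=> pz; elim: j i => [|j IH] [|i] lt_in; rewrite ?qbin0 //.
  by rewrite addn0 (qbin_prim0 pz).
by rewrite addnS !qbinS !IH //; apply: ltnW.
Qed.

(** A case of q-Lucas: the final 1 of row [n] starts a second copy of row [j], shifted by [n] and
    with the same q-Pascal coefficients because [z^n = 1]. The first summand is the unshifted copy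
    beyond column [n]. *)
Lemma qbin_prim_high (F : fieldType) n (z : F) i j : n.-primitive_root z ->
  qbin z (n + j) (n + i) = qbin z j (n + i) + qbin z j i.
Proof.
move=> pz; have zn := prim_expr_order pz.
elim: j i => [|j IH] i.
  rewrite addn0; case: i => [|i].
    by rewrite addn0 qbinn qbin0 (qbin_small _ (prim_order_gt0 pz)) add0r.
  by rewrite !qbin_small ?addr0 //; lia.
case: i => [|i].
  case: n pz zn IH => [/prim_order_gt0//|n] pz zn IH.
  rewrite addnS addn0 qbinS (qbin_prim_low _ pz) // [qbin z j.+1 n.+1]qbinS.
  have := IH 0%N; rewrite addn0 => ->.
  by rewrite !qbin0 zn; ring.
have -> : (n + i.+1 = (n + i).+1)%N by rewrite addnS.
by rewrite addnS !qbinS -!addnS !IH exprD zn; ring.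
Qed.

(** This supplies the upper end [k = n] of the telescoping sums. *)
Lemma qbin_prim_double (F : fieldType) n (z : F) d : n.-primitive_root z ->
  (d < n)%N -> qbin z (2 * n) (n + d) = if d is 0%N then 2 else 0.
Proof.
move=> pz lt_dn; rewrite mul2n -addnn (qbin_prim_high _ _ pz).
case: d lt_dn => [|d] lt_dn; first by rewrite addn0 qbinn qbin0.
by rewrite qbin_small ?(@qbin_prim0 _ n z d.+1) ?addr0 //; lia.
Qed.

(* The factor [(-z^(k+1); z)_(n-k)] is one factor longer than in the theorem,
   which makes the weights satisfy the recurrence [weightS] up to [k = n]; at
   an [n]-th root of unity the extra factor is [1 + z^n = 2]. *)
Definition weight (F : fieldType) (z : F) n k : F :=
  z ^- 'C(k.+1, 2) * qpoch (- z ^+ k.+1) z (n - k).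

Definition Bsum (F : fieldType) (z : F) n d : F :=
  \sum_(0 <= k < n) weight z n k * qbin z (2 * k) (k + d).

Definition Asum (F : fieldType) (z : F) n d : F :=
  \sum_(0 <= k < n) weight z n k * z ^- k * qbin z (2 * k) (k + d).

Lemma weightS (F : fieldType) (z : F) n k : z != 0 -> (k < n)%N ->
  weight z n k = z * z ^+ k * (1 + z * z ^+ k) * weight z n k.+1.
Proof.
move=> z0 lt_kn; rewrite /weight.
have -> : (n - k = (n - k.+1).+1)%N by lia.
rewrite qpochSl mulNr -exprSr opprK [in RHS]binS bin1 exprD exprS.
set P := qpoch _ _ _; set C := 'C(_, _).
by field; rewrite z0 !expf_neq0.
Qed.

Lemma weight_step1 (F : fieldType) (z : F) n k D a b c e :
  z != 0 -> (k < n)%N -> central_rel z (z ^+ k) D a b c e ->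
  weight z n k * (a + D * c)
    = (1 + D) * (z ^+ k.+1 * weight z n k.+1 * e - z ^+ k * weight z n k * b).
Proof.
move=> z0 lt_kn /central_rel_telescope1 H; rewrite weightS // exprS.
transitivity (z * z ^+ k * weight z n k.+1 * ((1 + z * z ^+ k) * (a + D * c))).
  by ring.
by rewrite H; ring.
Qed.

Lemma weight_step2 (F : fieldType) (z : F) n k D a b c e :
  z != 0 -> D != 0 -> (k < n)%N -> central_rel z (z ^+ k) D a b c e ->
  weight z n k * z ^- k * b = z * (weight z n k * (a + b + c))
    + ((z - z * (1 + D + D^-1) * z ^+ k.+1) * weight z n k.+1 * e
       - (z - z * (1 + D + D^-1) * z ^+ k) * weight z n k * b).
Proof.
move=> z0 D0 lt_kn /(central_rel_telescope2 D0) H; rewrite weightS // exprS.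
have zk0 := expf_neq0 k z0.
transitivity (weight z n k.+1 * (z * (1 + z * z ^+ k) * b)); first by field.
by rewrite H; ring.
Qed.

Lemma weight_n (F : fieldType) (z : F) n : n.-primitive_root z ->
  weight z n n = (-1) ^+ n.-1.
Proof.
move=> pz; rewrite /weight subnn /qpoch big_ord0 mulr1 binS bin1 exprD.
by rewrite (prim_expr_order pz) mulr1 (prim_expr_bin2 pz) -exprVn invrN invr1.
Qed.

Lemma weight_0 (F : fieldType) (z : F) n : n.-primitive_root z ->
  weight z n 0 = 1 - (-1) ^+ n.
Proof.
move=> pz; have n0 := prim_order_gt0 pz.
rewrite -(prim_prod1D pz) /weight bin_small // expr0 invr1 mul1r subn0 /qpoch.
under eq_bigr do rewrite mulNr opprK -exprD add1n.
case: n pz n0 => // n pz _.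
(* The exponents run over 1, ..., [n] on one side and 0, ..., [n - 1] on the other; [z^n = z^0]
   identifies the two products. *)
by rewrite big_ord_recr /= (prim_expr_order pz) mulrC [RHS]big_ord_recl.
Qed.

(** * Recurrences and closed forms for [Bsum] and [Asum] *)

Lemma Bsum_rec (F : fieldType) (z : F) n d : n.-primitive_root z ->
  (d.+1 < n)%N -> Bsum z n d = - z ^+ d.+1 * Bsum z n d.+2.
Proof.
move=> pz lt_dn; have z0 := prim_root_neq0 pz.
suff H : Bsum z n d + z ^+ d.+1 * Bsum z n d.+2 = 0.
  by rewrite mulNr; apply/eqP; rewrite -addr_eq0 H.
pose f k := z ^+ k * weight z n k * qbin z (2 * k) (k + d.+1).
transitivity ((1 + z ^+ d.+1) * \sum_(0 <= k < n) (f k.+1 - f k)).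
  rewrite /Bsum !mulr_sumr -big_split /=; apply: eq_big_nat => k /andP[_ lt_kn].
  rewrite -(weight_step1 z0 lt_kn (qbin_central_rel k d z0)); ring.
(* Both ends vanish: [[2n, n+d+1] = 0] at [z], and [[0, d+1] = 0]. *)
rewrite telescope_sumr // /f (qbin_prim_double pz) // qbin_small //.
by rewrite !mulr0 subr0 mulr0.
Qed.

Lemma Asum_Bsum (F : fieldType) (z : F) n d : n.-primitive_root z ->
  (d.+1 < n)%N ->
  Asum z n d.+1 = z * (Bsum z n d + Bsum z n d.+1 + Bsum z n d.+2).
Proof.
move=> pz lt_dn; have z0 := prim_root_neq0 pz; have D0 := expf_neq0 d.+1 z0.
(* The coefficient is the one found in [central_rel_telescope2], with [D = z ^+ d.+1]; both ends
   vanish as in [Bsum_rec]. *)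
pose f k := (z - z * (1 + z ^+ d.+1 + z ^- d.+1) * z ^+ k)
  * weight z n k * qbin z (2 * k) (k + d.+1).
transitivity (z * (Bsum z n d + Bsum z n d.+1 + Bsum z n d.+2)
    + \sum_(0 <= k < n) (f k.+1 - f k)).
  rewrite /Bsum -!big_split /= mulr_sumr -big_split /=.
  apply: eq_big_nat => k /andP[_ lt_kn].
  rewrite (weight_step2 z0 D0 lt_kn (qbin_central_rel k d z0)) /f.
  by rewrite !mulrDr.
rewrite telescope_sumr // /f (qbin_prim_double pz) // qbin_small //.
by rewrite !mulr0 subr0 addr0.
Qed.

(** By symmetry the neighbour at [d = -1] equals the one at [d = 1]. Here neither end vanishes: at
    both the coefficient is [z - 3 z = - 2 z], with [[2n, n] = 2] and [weight_n] above, [[0, 0] = 1]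
    and [weight_0] below. *)
Lemma Asum_Bsum0 (F : fieldType) (z : F) n : n.-primitive_root z ->
  Asum z n 0 = z * (Bsum z n 0 + 2 * Bsum z n 1)
    - 2 * z * (2 * (-1) ^+ n.-1 - (1 - (-1) ^+ n)).
Proof.
move=> pz; have z0 := prim_root_neq0 pz.
pose f k := (z - z * (1 + 1 + 1^-1) * z ^+ k)
  * weight z n k * qbin z (2 * k) (k + 0).
transitivity (z * (Bsum z n 1 + Bsum z n 0 + Bsum z n 1)
    + \sum_(0 <= k < n) (f k.+1 - f k)).
  rewrite /Bsum -!big_split /= mulr_sumr -big_split /=.
  apply: eq_big_nat => k /andP[_ lt_kn].
  have R := qbin_central_rel0 k z0.
  rewrite /f !addn0 addn1 (weight_step2 z0 (oner_neq0 _) lt_kn R).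
  by rewrite !mulrDr.
rewrite telescope_sumr // /f (qbin_prim_double pz) ?(prim_order_gt0 pz) //.
rewrite qbin0 weight_n // weight_0 // (prim_expr_order pz) invr1 expr0; ring.
Qed.

(** Descend by steps of two from [d = n], where every term vanishes because [2k < k + n]. *)
Lemma Bsum_even (F : fieldType) (z : F) n d j : n.-primitive_root z ->
  n = (d + 2 * j)%N -> Bsum z n d = 0.
Proof.
move=> pz; elim: j d => [|j IH] d En.
  rewrite /Bsum big_nat big1 // => k /andP[_ lt_kn].
  by rewrite qbin_small ?mulr0 //; lia.
by rewrite Bsum_rec // ?(IH d.+2) ?mulr0 //; lia.
Qed.

Lemma prim_expr_inv (F : fieldType) (z : F) n i j : n.-primitive_root z ->
  n = (i + j)%N -> z ^+ i = z ^- j.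
Proof.
move=> pz En; have zj0 := expf_neq0 j (prim_root_neq0 pz).
apply: (mulIf zj0); rewrite mulVf // -exprD -En; exact: prim_expr_order pz.
Qed.

(** Descend by steps of two from [d = n - 1], where only [k = n - 1] contributes. A step to [j + 1]
    multiplies by [- z^(d+1) = - z^-(2j+2)], and these exponents add up to [j^2 + j]. *)
Lemma Bsum_odd (F : fieldType) (z : F) n d j : n.-primitive_root z ->
  n = (d + (2 * j).+1)%N ->
  Bsum z n d = 2 * (-1) ^+ (d + j) * z ^- (j ^ 2 + j).
Proof.
move=> pz; have z0 := prim_root_neq0 pz; elim: j d => [|j IH] d En.
  have {}En : n = d.+1 by lia.
  rewrite En /Bsum big_nat_recr //= big_nat big1 ?add0r; last first.
    by move=> k /andP[_ lt_kd]; rewrite qbin_small ?mulr0 //; lia.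
  rewrite mul2n -addnn qbinn /weight -En (prim_expr_bin2 pz).
  have -> : (n - d = 1)%N by lia.
  rewrite /qpoch big_ord_recl big_ord0 expr0 En -{2}En (prim_expr_order pz) /=.
  by rewrite addn0 -exprVn invrN invr1; field.
rewrite Bsum_rec // ?(IH d.+2); try lia.
rewrite (@prim_expr_inv _ z n d.+1 (2 * j + 2) pz); last lia.
have -> : (j.+1 ^ 2 + j.+1 = (j ^ 2 + j) + (2 * j + 2))%N by nia.
rewrite [z ^+ (_ + (_ + 2))]exprD invfM.
set X := (z ^+ (2 * j + 2))^-1; set Y := (z ^+ _)^-1.
by rewrite addnS !addSn !exprS; ring.
Qed.

(** The neighbours of [Bsum z n d] vanish, so only [z] times this term is left. For [d = 0] the
    order [n] is odd and the boundary correction is 0. *)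
Lemma Asum_odd (F : fieldType) (z : F) n d j : n.-primitive_root z ->
  n = (d + (2 * j).+1)%N ->
  Asum z n d = 2 * ((-1) ^+ (d + j) * (z * z ^- (j ^ 2 + j))).
Proof.
move=> pz En.
have B0 : Bsum z n d.+1 = 0 by apply: (@Bsum_even _ _ _ _ j pz); lia.
case: d En B0 => [|d] En B0.
  rewrite Asum_Bsum0 // B0 (Bsum_odd pz En) En /= add0n exprS.
  by rewrite mulnC exprM sqrr_sign; ring.
rewrite Asum_Bsum //; last lia.
rewrite B0 (Bsum_odd pz En) (@Bsum_even _ _ _ d j.+1 pz); last lia.
by ring.
Qed.

(** Here [Bsum z n d = 0] and only the neighbours contribute; the ratio of their values gives the
    last factor. For [d = 0] both sides are 0, the boundary correction cancelling the term in
    [Bsum z n 1]. *)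
Lemma Asum_even (F : fieldType) (z : F) n d j : n.-primitive_root z ->
  n = (d + 2 * j.+1)%N ->
  Asum z n d
    = 2 * ((-1) ^+ (d + j) * (z * z ^- (j.+1 ^ 2 + j.+1)) * (1 - z ^+ (2 * j.+1))).
Proof.
move=> pz En; have z0 := prim_root_neq0 pz.
have B0 : Bsum z n d = 0 by apply: (@Bsum_even _ _ _ _ j.+1 pz).
have E : z ^+ (j.+1 ^ 2 + j.+1) = z ^+ (2 * j.+1) * z ^+ (j ^ 2 + j).
  by rewrite -exprD; congr (_ ^+ _); nia.
case: d En B0 => [|d] En B0.
  rewrite add0n in En.
  have H1 := @Bsum_odd _ _ _ 1 j pz ltac:(lia).
  rewrite Asum_Bsum0 // B0 H1 -En (prim_expr_order pz) subrr !mulr0.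
  (* Since [n = 2 (j + 1)], [z^(j+1) = -1], and [j^2 + j = (j + 1) j]. *)
  have -> : z ^+ (j ^ 2 + j) = (-1) ^+ j.
    move: pz; rewrite En => /prim_half <-.
    by rewrite -exprM; congr (_ ^+ _); nia.
  have -> : (-1) ^+ n = 1 :> F by rewrite En exprM sqrrN expr1n expr1n.
  have -> : (-1) ^+ n.-1 = -1 :> F.
    have -> : (n.-1 = (2 * j).+1)%N by lia.
    by rewrite exprS exprM sqrrN !expr1n mulr1.
  rewrite -exprVn invrN invr1 add1n exprS.
  have -> : 2 * (-1 * (-1) ^+ j) * (-1) ^+ j = -2 :> F.
    transitivity (-2 * ((-1) ^+ j * (-1) ^+ j) : F); first by ring.
    by rewrite -expr2 sqrr_sign mulr1.
  by ring.
rewrite Asum_Bsum //; last lia.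
rewrite B0 (@Bsum_odd _ _ _ d j.+1 pz); last lia.
rewrite (@Bsum_odd _ _ _ d.+2 j pz); last lia.
rewrite E; set Z := z ^+ (2 * j.+1); set Y := z ^+ (j ^ 2 + j).
rewrite !addSn !addnS !exprS; field.
by rewrite !expf_neq0.
Qed.

(** * The sums of the theorem in terms of [Asum] and [Bsum] *)

Lemma half_k_k3 k : ((k%:Z * (k%:Z + 3)) %/ 2)%Z = ('C(k.+1, 2) + k)%N.
Proof.
rewrite (_ : k%:Z * (k%:Z + 3) = 2 * ('C(k.+1, 2) + k)%N%:Z) ?mulKz //.
elim: k => [|k IH]; first by [].
rewrite binS bin1; move: IH; rewrite !PoszD; lia.
Qed.

Lemma prim_qpoch_weight (F : fieldType) (z : F) n k :
  n.-primitive_root z -> (k < n)%N ->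
  2 * (z ^ (- ((k%:Z * (k%:Z + 3)) %/ 2)%Z)
       * qpoch (- z ^+ (k + 1)) z (n - k - 1))
    = weight z n k * z ^- k.
Proof.
move=> pz lt_kn; have z0 := prim_root_neq0 pz.
rewrite half_k_k3 -exprnN exprD invfM /weight.
have [p En] : exists p, n = (k.+1 + p)%N by exists (n - k.+1)%N; lia.
have -> : (n - k = p.+1)%N by lia.
rewrite subn1 addn1 qpochSr mulNr opprK -exprD -En (prim_expr_order pz) /=.
by ring.
Qed.

Lemma sum1_Asum (F : fieldType) (z : F) n d : n.-primitive_root z ->
  2 * (\sum_(0 <= k < n)
        z ^ (- ((k%:Z * (k%:Z + 3)) %/ 2)%Z) * qbin z (2 * k) (k + d)
        * qpoch (- z ^+ (k + 1)) z (n - k - 1)) = Asum z n d.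
Proof.
move=> pz; rewrite mulr_sumr; apply: eq_big_nat => k /andP[_ lt_kn].
by rewrite -prim_qpoch_weight //; ring.
Qed.

(** The factor [1 + z^(n-1)] lengthens each product at its upper end. Taking out the lowest factor
    [1 + z^k] instead leaves the product of the first sum, and [z^-k (1 + z^k) = z^-k + 1] separates
    the two sums. *)
Lemma sum2_Asum_Bsum (F : fieldType) (z : F) n d : n.-primitive_root z ->
  2 * ((1 + z ^+ n.-1) * \sum_(0 <= k < n)
        z ^ (- ((k%:Z * (k%:Z + 3)) %/ 2)%Z) * qbin z (2 * k) (k + d)
        * qpoch (- z ^+ k) z (n - k - 1)) = Asum z n d + Bsum z n d.
Proof.
move=> pz; have z0 := prim_root_neq0 pz.
rewrite !mulr_sumr -big_split; apply: eq_big_nat => k /andP[_ lt_kn] /=.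
have zk0 := expf_neq0 k z0.
have H : (1 + z ^+ n.-1) * qpoch (- z ^+ k) z (n - k - 1)
    = (1 + z ^+ k) * qpoch (- z ^+ (k + 1)) z (n - k - 1).
  have E : (n.-1 = k + (n - k - 1))%N by lia.
  rewrite {1}E; transitivity (qpoch (- z ^+ k) z (n - k - 1).+1).
    by rewrite qpochSr exprD; ring.
  by rewrite qpochSl mulNr -exprSr addn1; ring.
transitivity ((2 * (z ^ (- ((k%:Z * (k%:Z + 3)) %/ 2)%Z)
    * qpoch (- z ^+ (k + 1)) z (n - k - 1)))
    * (1 + z ^+ k) * qbin z (2 * k) (k + d)).
  set Q := qpoch (- z ^+ k) _ _ in H *; set w := z ^ _.
  transitivity (2 * w * ((1 + z ^+ n.-1) * Q) * qbin z (2 * k) (k + d)).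
    by ring.
  by rewrite H; ring.
by rewrite prim_qpoch_weight //; field.
Qed.

Lemma exprz_1B (F : fieldType) (z : F) i : z != 0 ->
  z ^ (1 - i%:Z) = z * z ^- i.
Proof. by move=> z0; rewrite expfzDr // -exprnN. Qed.

(** As [z^(n-1) = z^-1], vanishing would force [z = -1], which has order 2. *)
Lemma prim_1D_neq0 (z : algC) n : n.-primitive_root z -> n != 2%N ->
  1 + z ^+ n.-1 != 0.
Proof.
move=> pz n2; have n0 := prim_order_gt0 pz; have z0 := prim_root_neq0 pz.
rewrite (@prim_expr_inv _ z n n.-1 1 pz) ?expr1; last lia.
apply/eqP => H; have z1 : z = -1.
  by apply: (mulIf (invr_neq0 z0)); rewrite mulfV // mulN1r;
    rewrite -[LHS](addrK z^-1) H sub0r.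
have : (n %| 2)%N by rewrite (prim_order_dvd pz) z1 sqrrN expr1n.
move/dvdn_leq => /(_ isT) le_n2; have n1 : n = 1%N by lia.
have := prim_expr_order pz; rewrite n1 expr1 z1 => /eqP.
by rewrite eq_sym -subr_eq0 opprK -mulr2n Num.Theory.pnatr_eq0.
Qed.

(** In this case [Asum] is [z] times [Bsum], so their sum is [1 + z^-1] times [Asum] and the factor
    [1 + z^(n-1)] cancels. *)
Lemma sum2_odd (z : algC) n d j : n.-primitive_root z ->
  n = (d + (2 * j).+1)%N ->
  \sum_(0 <= k < n)
     z ^ (- ((k%:Z * (k%:Z + 3)) %/ 2)%Z) * qbin z (2 * k) (k + d)
     * qpoch (- z ^+ k) z (n - k - 1)
  = (-1) ^+ (d + j) * (z * z ^- (j ^ 2 + j)).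
Proof.
move=> pz En; have z0 := prim_root_neq0 pz.
have two : 2 != 0 :> algC by rewrite Num.Theory.pnatr_eq0.
have [n2|n2] := eqVneq n 2%N.
  have [-> ->] : d = 1%N /\ j = 0%N by lia.
  have zN1 : z = -1 by move: pz; rewrite n2 => /(@prim_half _ 1); rewrite expr1.
  rewrite n2 big_nat_recr //= big_nat1 !half_k_k3 -!exprnN zN1 /qpoch /=.
  by rewrite !big_ord0 binn -[(0 ^ 2 + 0)%N]/0%N !addn0 expr0; field.
apply: (mulfI two); apply: (mulfI (prim_1D_neq0 pz n2)).
rewrite mulrCA sum2_Asum_Bsum // (Asum_odd pz En) (Bsum_odd pz En).
rewrite (@prim_expr_inv _ z n n.-1 1 pz) ?expr1; last by rewrite En; lia.
by field; rewrite z0 expf_neq0.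
Qed.

(** This gives the quotient of [1 - q^(2j)] by [1 + q] in polynomial form, which can be evaluated
    even at [q = -1], the case [n = 2]. *)
Lemma geometric_1D (R : comNzRingType) (q : R) j :
  (1 + q) * ((1 - q) * \sum_(i < j) q ^+ (2 * i)) = 1 - q ^+ (2 * j).
Proof.
elim: j => [|j IH]; first by rewrite big_ord0 muln0 expr0; ring.
rewrite big_ord_recr /= !mulrDr IH.
have -> : (2 * j.+1 = (2 * j).+2)%N by lia.
by rewrite !exprS; ring.
Qed.

(** Here [Bsum] vanishes; dividing [Asum] by [1 + z^-1 = (1 + z) / z] yields the extra [z] and the
    quotient by [1 + z]. *)
Lemma sum2_even (z : algC) n d j : n.-primitive_root z ->
  n = (d + 2 * j.+1)%N ->
  \sum_(0 <= k < n)
     z ^ (- ((k%:Z * (k%:Z + 3)) %/ 2)%Z) * qbin z (2 * k) (k + d)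
     * qpoch (- z ^+ k) z (n - k - 1)
  = (-1) ^+ (d + j) * (z ^+ 2 * z ^- (j.+1 ^ 2 + j.+1))
    * ((1 - z) * \sum_(i < j.+1) z ^+ (2 * i)).
Proof.
move=> pz En; have z0 := prim_root_neq0 pz.
have two : 2 != 0 :> algC by rewrite Num.Theory.pnatr_eq0.
have [n2|n2] := eqVneq n 2%N.
  have [-> ->] : d = 0%N /\ j = 0%N by lia.
  have zN1 : z = -1 by move: pz; rewrite n2 => /(@prim_half _ 1); rewrite expr1.
  rewrite n2 big_nat_recr //= big_nat1 !half_k_k3 -!exprnN zN1 /qpoch /=.
  rewrite !big_ord_recl !big_ord0 /= binn -[(1 ^ 2 + 1)%N]/2%N.
  rewrite -['C(1, 2)]/0%N muln0 !addn0.
  by rewrite !expr0; field.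
apply: (mulfI two); apply: (mulfI (prim_1D_neq0 pz n2)).
rewrite mulrCA sum2_Asum_Bsum // (Asum_even pz En) (Bsum_even pz En) addr0.
rewrite -geometric_1D (@prim_expr_inv _ z n n.-1 1 pz) ?expr1;
  last by rewrite En; lia.
set Y := z ^+ (_ + _); set G := \sum_(i < _) _.
by field; rewrite z0 expf_neq0.
Qed.

(** * Evaluation of Laurent polynomials and reduction modulo Phi_n *)

(* A relation rather than a function, which spares proving that the value does
   not depend on how [f] is written as a quotient. *)
Definition evals_to (z : algC) (f : Zq) (v : algC) : Prop :=
  exists (p : {poly int}) (m : nat),
    f = tofrac p / qvar ^+ m /\ v = (map_poly intr p).[z] / z ^+ m.

Lemma qvar_neq0 : qvar != 0.
Proof. by rewrite /qvar tofrac_eq0 polyX_eq0. Qed.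

Lemma qvar_expr_neq1 i : qvar ^+ i.+1 != 1.
Proof.
rewrite /qvar -tofracXn -tofrac1 tofrac_eq.
apply/eqP => /(congr1 (fun p : {poly int} => size p)).
by rewrite size_polyXn size_poly1.
Qed.

Lemma evals_to_poly z p : evals_to z (tofrac p) (map_poly intr p).[z].
Proof. by exists p, 0%N; rewrite !expr0 !divr1. Qed.

Lemma evals_to_qvar z : evals_to z qvar z.
Proof. by have := evals_to_poly z 'X; rewrite map_polyX hornerX. Qed.

Lemma evals_to0 z : evals_to z 0 0.
Proof. by have := evals_to_poly z 0; rewrite tofrac0 rmorph0 horner0. Qed.

Lemma evals_to1 z : evals_to z 1 1.
Proof. by have := evals_to_poly z 1; rewrite tofrac1 rmorph1 hornerC. Qed.

Lemma evals_toD z f g u v : z != 0 ->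
  evals_to z f u -> evals_to z g v -> evals_to z (f + g) (u + v).
Proof.
move=> z0 [p [m [-> ->]]] [r [l [-> ->]]].
exists (p * 'X^l + r * 'X^m), (m + l)%N; split.
  by rewrite tofracD !tofracM !tofracXn exprD addf_div ?expf_neq0 ?qvar_neq0.
by rewrite rmorphD !rmorphM /= !map_polyXn !hornerE exprD addf_div ?expf_neq0.
Qed.

Lemma evals_toM z f g u v : z != 0 ->
  evals_to z f u -> evals_to z g v -> evals_to z (f * g) (u * v).
Proof.
move=> z0 [p [m [-> ->]]] [r [l [-> ->]]].
exists (p * r), (m + l)%N; split.
  by rewrite tofracM exprD mulf_div.
by rewrite rmorphM hornerM exprD mulf_div.
Qed.

Lemma evals_toN z f u : evals_to z f u -> evals_to z (- f) (- u).
Proof.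
move=> [p [m [-> ->]]]; exists (- p), m.
by rewrite tofracN rmorphN hornerN !mulNr.
Qed.

Lemma evals_toX z f u i : z != 0 ->
  evals_to z f u -> evals_to z (f ^+ i) (u ^+ i).
Proof.
move=> z0 fu; elim: i => [|i IH]; first exact: evals_to1.
by rewrite !exprS; apply: evals_toM.
Qed.

Lemma evals_to_qvarz z (i : int) : z != 0 -> evals_to z (qvar ^ i) (z ^ i).
Proof.
move=> z0; case: i => i.
  by rewrite -!exprnP; apply: evals_toX => //; apply: evals_to_qvar.
exists 1, i.+1; rewrite NegzE -!exprnN tofrac1 rmorph1 hornerC.
by rewrite !mul1r.
Qed.

Lemma evals_to_qpoch z f u i : z != 0 -> evals_to z f u ->
  evals_to z (qpoch f qvar i) (qpoch u z i).
Proof.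
move=> z0 fu; rewrite /qpoch.
apply: (big_ind2 (evals_to z)); first exact: evals_to1.
  by move=> *; apply: evals_toM.
move=> k _; apply: evals_toD => //; first exact: evals_to1.
by apply/evals_toN/evals_toM => //; apply/evals_toX/evals_to_qvar.
Qed.

(** The quotient formula is replaced by the recursion before evaluation, since its denominator may
    vanish at [z]. *)
Lemma evals_to_qbinom z m j : z != 0 ->
  evals_to z (qbinom qvar m j) (qbin z m j).
Proof.
move=> z0; rewrite (qbinomE m j qvar_neq0 qvar_expr_neq1).
elim: m j => [|m IH] [|j]; rewrite ?qbin0; try exact: evals_to1.
  exact: evals_to0.
rewrite !qbinS; apply: evals_toD => //.
by apply: evals_toM => //; apply/evals_toX/evals_to_qvar.
Qed.

Lemma evals_to_sum z n d (e : nat -> nat) : z != 0 ->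
  evals_to z
    (\sum_(0 <= k < n)
        qvar ^ (- ((k%:Z * (k%:Z + 3)) %/ 2)%Z) * qbinom qvar (2 * k)%N (k + d)%N
        * qpoch (- qvar ^+ (e k)) qvar (n - k - 1)%N)
    (\sum_(0 <= k < n)
        z ^ (- ((k%:Z * (k%:Z + 3)) %/ 2)%Z) * qbin z (2 * k)%N (k + d)%N
        * qpoch (- z ^+ (e k)) z (n - k - 1)%N).
Proof.
move=> z0; apply: (big_ind2 (evals_to z)); first exact: evals_to0.
  by move=> *; apply: evals_toD.
move=> k _; apply: evals_toM => //.
  by apply: evals_toM => //; [apply: evals_to_qvarz|apply: evals_to_qbinom].
by apply/evals_to_qpoch/evals_toN/evals_toX/evals_to_qvar.
Qed.

(** Division by the monic ['Phi_n] stays over the integers. The remainder vanishes at [z] but is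
    smaller than the minimal polynomial of [z], so it is 0. *)
Lemma Cyclotomic_dvd n (z : algC) (p : {poly int}) : n.-primitive_root z ->
  (map_poly intr p).[z] = 0 -> exists r, p = r * 'Phi_n.
Proof.
move=> pz pz0; have mon := Cyclotomic_monic n.
have := Pdiv.RingMonic.rdivp_eq mon p.
set s := Pdiv.CommonRing.rmodp p _; set r := Pdiv.CommonRing.rdivp p _ => Ep.
suff s0 : s = 0 by exists r; rewrite {1}Ep s0 addr0.
have sz0 : (map_poly intr s).[z] = 0.
  have : root (cyclotomic z n) z by rewrite root_cyclotomic.
  rewrite -(Cintr_Cyclotomic pz) => /rootP Phi0.
  move: pz0; rewrite Ep rmorphD rmorphM /= hornerD hornerM Phi0 mulr0.
  by rewrite add0r.
apply/eqP; apply: contraT => s_neq0.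
have lt_s : (size s < size ('Phi_n : {poly int}))%N.
  by apply: Pdiv.Ring.ltn_rmodpN0; apply: monic_neq0.
have [f [Df _] dv] := minCpolyP z.
pose t : {poly rat} := map_poly intr s.
have : f %| t.
  rewrite -dv /root /t -map_poly_comp (_ : map_poly _ s = map_poly intr s) ?sz0 //.
  by apply: eq_map_poly => a; rewrite /= ratr_int.
move/dvdp_leq; rewrite -size_poly_eq0 /t (size_map_inj_poly intr_inj) //.
rewrite size_poly_eq0 => /(_ s_neq0).
rewrite -(size_map_poly (@ratr algC)) -Df (minCpoly_cyclotomic pz).
by rewrite size_cyclotomic -size_Cyclotomic leqNgt lt_s.
Qed.

(** The difference is [s / q^i] with [s] vanishing at [z], so ['Phi_n] divides [s]. *)
Lemma evals_to_eqmod n (z : algC) f g v : n.-primitive_root z ->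
  evals_to z f v -> evals_to z g v -> laurent_eqmod (Phi n) f g.
Proof.
move=> pz Hf Hg; have z0 := prim_root_neq0 pz.
have := evals_toD z0 Hf (evals_toN Hg); rewrite subrr.
case=> [s [i [Efg /esym/eqP]]].
rewrite mulf_eq0 invr_eq0 (negPf (expf_neq0 i z0)) orbF => /eqP.
move=> /(Cyclotomic_dvd pz)[t Es].
case: Hf Hg => [p [m [Ef _]]] [r [l [Eg _]]].
split; [by exists p, m|by exists r, l|].
exists (tofrac t / qvar ^+ i); first by exists t, i.
by rewrite Efg Es tofracM /Phi mulrCA mulrA.
Qed.

Lemma evals_to_quotient z j : z != 0 ->
  evals_to z ((1 - qvar ^+ (2 * j)) / (1 + qvar))
    ((1 - z) * \sum_(i < j) z ^+ (2 * i)).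
Proof.
move=> z0; have E : 1 + qvar != 0.
  rewrite addr_eq0 eq_sym eqr_oppLR; apply/eqP => H.
  by have := qvar_expr_neq1 1; rewrite H sqrrN expr1n eqxx.
rewrite -geometric_1D mulrC mulKf //.
have X i : evals_to z (qvar ^+ i) (z ^+ i) by apply/evals_toX/evals_to_qvar.
apply: evals_toM => //.
  by apply: evals_toD; [|exact: evals_to1|apply/evals_toN/(X 1%N)].
apply: (big_ind2 (evals_to z)) => [|*|i _] //; first exact: evals_to0.
exact: evals_toD.
Qed.

Theorem corollary4p4 (n d : nat) (hn : (1 <= n)%N) (hd : (d < n)%N) :
  laurent_eqmod (Phi n)
    (\sum_(0 <= k < n)
        qvar ^ (- ((k%:Z * (k%:Z + 3)) %/ 2)%Z) * qbinom qvar (2 * k)%N (k + d)%N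
        * qpoch (- qvar ^+ (k + 1)) qvar (n - k - 1)%N)
    (if ~~ odd (n - d) then
       (-1) ^ ((n%:Z + d%:Z - 2) %/ 2)%Z
       * qvar ^ ((5 - (n%:Z - d%:Z + 1) ^+ 2) %/ 4)%Z
       * (1 - qvar ^+ (n - d))
     else
       (-1) ^ ((n%:Z + d%:Z - 1) %/ 2)%Z
       * qvar ^ ((5 - (n%:Z - d%:Z) ^+ 2) %/ 4)%Z)
  /\
  laurent_eqmod (Phi n)
    (\sum_(0 <= k < n)
        qvar ^ (- ((k%:Z * (k%:Z + 3)) %/ 2)%Z) * qbinom qvar (2 * k)%N (k + d)%N
        * qpoch (- qvar ^+ k) qvar (n - k - 1)%N)
    (if ~~ odd (n - d) then
       (-1) ^ ((n%:Z + d%:Z - 2) %/ 2)%Z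
       * qvar ^ ((9 - (n%:Z - d%:Z + 1) ^+ 2) %/ 4)%Z
       * ((1 - qvar ^+ (n - d)) / (1 + qvar))
     else
       (-1) ^ ((n%:Z + d%:Z - 1) %/ 2)%Z
       * qvar ^ ((5 - (n%:Z - d%:Z) ^+ 2) %/ 4)%Z).
Proof.
have [z pz] := C_prim_root_exists hn; have z0 := prim_root_neq0 pz.
have two : 2 != 0 :> algC by rewrite Num.Theory.pnatr_eq0.
have Hs i (e : int) : evals_to z ((-1) ^ (i%:Z) * qvar ^ e) ((-1) ^+ i * z ^ e).
  apply: evals_toM => //; last exact: evals_to_qvarz.
  by rewrite -exprnP; apply/evals_toX/evals_toN/evals_to1.
have H1 := evals_to_sum n d (fun k => k + 1)%N z0.
have H2 := evals_to_sum n d id z0.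
case: ifPn => [ev_nd|]; last rewrite negbK => odd_nd.
- have [j En] : exists j, n = (d + 2 * j.+1)%N by exists (n - d)./2.-1; lia.
  have -> : ((n%:Z + d%:Z - 2) %/ 2)%Z = (d + j)%N%:Z by lia.
  (* The divisions by 4 are exact: [(2m + 1)^2 = 4 (m^2 + m) + 1], with [m = j + 1] here and [m = j]
     in the odd case. *)
  have E1 : 5 - (n%:Z - d%:Z + 1) ^+ 2 = 4 * (1 - (j.+1 ^ 2 + j.+1)%N%:Z).
    by rewrite En; nia.
  have -> : 9 - (n%:Z - d%:Z + 1) ^+ 2 = 4 * (1 + (1 - (j.+1 ^ 2 + j.+1)%N%:Z)).
    by rewrite mulrDr -E1; ring.
  rewrite {}E1 !mulKz // (_ : n - d = 2 * j.+1)%N; last lia.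
  split.
    apply: (evals_to_eqmod pz H1).
    have -> := mulfI two (etrans (sum1_Asum d pz) (Asum_even pz En)).
    rewrite -exprz_1B //; apply: evals_toM => //.
    apply: evals_toD => //; first exact: evals_to1.
    exact/evals_toN/evals_toX/evals_to_qvar.
  apply: (evals_to_eqmod pz H2).
  have Ez : z ^ (1 + (1 - (j.+1 ^ 2 + j.+1)%N%:Z)) = z ^+ 2 * z ^- (j.+1 ^ 2 + j.+1).
    by rewrite expfzDr // exprz_1B // expr1z mulrA -expr2.
  rewrite (sum2_even pz En) -Ez.
  by apply: evals_toM => //; apply: evals_to_quotient.
- have [j En] : exists j, n = (d + (2 * j).+1)%N by exists (n - d)./2; lia.
  have -> : ((n%:Z + d%:Z - 1) %/ 2)%Z = (d + j)%N%:Z by lia.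
  have -> : 5 - (n%:Z - d%:Z) ^+ 2 = 4 * (1 - (j ^ 2 + j)%N%:Z).
    by rewrite En; nia.
  rewrite mulKz //; split.
    apply: (evals_to_eqmod pz H1).
    have -> := mulfI two (etrans (sum1_Asum d pz) (Asum_odd pz En)).
    by rewrite -exprz_1B.
  by apply: (evals_to_eqmod pz H2); rewrite (sum2_odd pz En) -exprz_1B.
Qed.
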